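(* Let $d\geq 2$ and $k\geq 2$ be integers. A finite set $X\subset\mathbb{R}^d$ with at least two points is a $k$-antipodal point set in $\mathbb{R}^d$ if and only if there exists $\mathbf{K}_{\mathbf{o}}\in\mathcal{K}_{\mathbf{o}}^{d}$ such that $X$ is a $k$-diametral point set in $\mathbb{M}^d_{\mathbf{K}_{\mathbf{o}}}$; consequently $$G_k(d)=\max_{\mathbf{K}_{\mathbf{o}}\in\mathcal{K}_{\mathbf{o}}^{d}} g_k(\mathbb{M}^d_{\mathbf{K}_{\mathbf{o}}}).$$ Moreover, for all $d\geq 3$ and $k\geq 3$, $$k\cdot 2^{d-1}\leq G_k(d)\leq (k-1)2^d-1 .$$
   Context: $\mathcal{K}_{\mathbf{o}}^{d}$ is the family of $\mathbf{o}$-symmetric convex bodies in $\mathbb{R}^d$ (compact convex sets with nonempty interior, symmetric about the origin $\mathbf{o}$). For $\mathbf{K}_{\mathbf{o}}\in\mathcal{K}_{\mathbf{o}}^{d}$ let $\|\mathbf{x}\|_{\mathbf{K}_{\mathbf{o}}}=\min\{\lambda\geq 0 : \mathbf{x}\in\lambda\mathbf{K}_{\mathbf{o}}\}$, and let $\mathbb{M}^d_{\mathbf{K}_{\mathbf{o}}}$ denote $\mathbb{R}^d$ equipped with this norm. A finite set $X$ of (distinct) points, of positive diameter in $\mathbb{M}^d_{\mathbf{K}_{\mathbf{o}}}$, is a $k$-diametral point set in $\mathbb{M}^d_{\mathbf{K}_{\mathbf{o}}}$ if any $k$ distinct points of $X$ include two points whose $\|\cdot\|_{\mathbf{K}_{\mathbf{o}}}$-distance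 equals the diameter of $X$. $g_k(\mathbb{M}^d_{\mathbf{K}_{\mathbf{o}}})$ is the largest cardinality of a $k$-diametral point set in $\mathbb{M}^d_{\mathbf{K}_{\mathbf{o}}}$. A finite set $X$ of (distinct) points in $\mathbb{R}^d$ is a $k$-antipodal point set if any $k$ distinct points of $X$ include two points lying on distinct parallel supporting hyperplanes of $\mathrm{conv}(X)$ (one point on each). $G_k(d)$ is the largest cardinality of a $k$-antipodal point set in $\mathbb{R}^d$. *)

(* Defs.v *)
From HB Require Import structures.
From mathcomp Require Import all_boot all_order all_algebra finmap.
From mathcomp Require Import boolp classical_sets reals topology normedtype convex.
Set Implicit Arguments.
Unset Strict Implicit.
Unset Printing Implicit Defensive.
Import Order.TTheory GRing.Theory Num.Theory.
Import numFieldNormedType.Exports.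
Local Open Scope classical_set_scope.
Local Open Scope ring_scope.

Definition is_maximum (A : set nat) (m : nat) : Prop := A m /\ ubound A m.

(* Junk value 0 when A has no largest element; whenever it matters, pair it
   with [is_maximum A (maximum A)]. *)
Definition maximum (A : set nat) : nat := xget 0%N (is_maximum A).

Section Euclidean.
Variables (R : realType) (d : nat).
Local Notation V := 'rV[R]_d.
Implicit Types (K C H : set V) (X Y : {fset V}) (u x y : V).

Definition o_symmetric_convex_body K : Prop :=
  [/\ compact K, convex_set K, interior K !=set0 & forall x, K x -> K (- x)].

(* For a convex body the infimum is attained, so this is the minimum. *)
Definition gauge_norm K x : R :=
  inf [set l : R | 0 <= l /\ ([set l *: y | y in K]) x].

Definition diameter K X : R :=
  sup [set gauge_norm K (p.1 - p.2) | p in [set` X] `*` [set` X]].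

Definition k_diametral K (k : nat) X : Prop :=
  0 < diameter K X /\
  forall Y, (Y `<=` X)%fset -> #|` Y| = k ->
    exists x y, [/\ x \in Y, y \in Y, x != y &
                    gauge_norm K (x - y) = diameter K X].

Definition g_ (k : nat) K : nat :=
  maximum [set #|` X| | X in [set X | k_diametral K k X]].

Definition conv_hull (A : set V) : set V := smallest (@convex_set R V) A.

Definition dot u x : R := (u *m x^T) ord0 ord0.

Definition hyperplane u (c : R) : set V := [set x | dot u x = c].

Definition parallel H1 H2 : Prop :=
  exists u a b, [/\ u != 0, H1 = hyperplane u a & H2 = hyperplane u b].

(* Which of the two closed half-spaces contains C is absorbed by the sign
   of the normal vector u. *)
Definition supporting C H : Prop :=
  H `&` C !=set0 /\
  exists u c, [/\ u != 0, H = hyperplane u c & C `<=` [set x | dot u x <= c]].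

Definition k_antipodal (k : nat) X : Prop :=
  forall Y, (Y `<=` X)%fset -> #|` Y| = k ->
    exists x y, [/\ x \in Y, y \in Y, x != y &
      exists H1 H2, [/\ supporting (conv_hull [set` X]) H1,
                        supporting (conv_hull [set` X]) H2,
                        parallel H1 H2 /\ H1 <> H2, H1 x & H2 y]].

Definition G_ (k : nat) : nat :=
  maximum [set #|` X| | X in [set X | k_antipodal k X]].

End Euclidean.

Arguments G_ R d k : clear implicits.

(* Main.v *)
Require Import Defs.
From mathcomp Require Import all_boot all_order all_algebra finmap.
From mathcomp Require Import boolp classical_sets reals topology normedtype
  convex.
From mathcomp Require Import derive interval_inference.
From mathcomp Require Import zify ring lra.
Import Order.TTheory GRing.Theory Num.Theory.
Import numFieldNormedType.Exports.
Local Open Scope classical_set_scope.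
Local Open Scope ring_scope.

(* Two points x, y of X are antipodal when some linear form attains its minimum
   over X at y and its maximum, strictly larger, at x.  The norm whose unit ball
   is cut out by these forms, normalised to u.(x - y) = 1, together with a large
   box, makes every antipodal pair diametral;
     conversely a form of the polar body
   that norms x - y makes a diametral pair antipodal.

   Upper bound: antipodal points x, y have disjoint half-size copies (x + U)/2
     and
   (y + U)/2 inside a bounded open convex set U, so the |X| half-size copies of
     U
   cover no point more than k - 1 times, and comparing volumes gives
   |X| <= (k - 1) 2^d.  The inequality is strict when k >= 3 because points near
     an
   exposed point of X are covered at most once.  Lower bound: k equally spaced
   points on a line times the vertices of a (d - 1)-cube. *)

(** * Linear forms and normals of hyperplanes *)

Section Dot.
Context {R : realType} {d : nat}.
Local Notation V := 'rV[R]_d.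
Implicit Types u v x y z : V.

Lemma dotE u x : dot u x = \sum_j u ord0 j * x ord0 j.
Proof. by rewrite /dot mxE; apply: eq_bigr => j _; rewrite mxE. Qed.

Lemma dotDr u x y : dot u (x + y) = dot u x + dot u y.
Proof. by rewrite /dot linearD mulmxDr mxE. Qed.

Lemma dotNr u x : dot u (- x) = - dot u x.
Proof. by rewrite /dot linearN mulmxN mxE. Qed.

Lemma dotBr u x y : dot u (x - y) = dot u x - dot u y.
Proof. by rewrite dotDr dotNr. Qed.

Lemma dotZr u (a : R) x : dot u (a *: x) = a * dot u x.
Proof. by rewrite /dot linearZ -scalemxAr mxE. Qed.

Lemma dotC u x : dot u x = dot x u.
Proof. by rewrite !dotE; apply: eq_bigr => j _; rewrite mulrC. Qed.

Lemma dotDl u v x : dot (u + v) x = dot u x + dot v x.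
Proof. by rewrite dotC dotDr !(dotC x). Qed.

Lemma dotNl u x : dot (- u) x = - dot u x.
Proof. by rewrite dotC dotNr dotC. Qed.

Lemma dotZl (a : R) u x : dot (a *: u) x = a * dot u x.
Proof. by rewrite dotC dotZr dotC. Qed.

Lemma dot0r u : dot u 0 = 0.
Proof. by rewrite -(scale0r 0) dotZr mul0r. Qed.

Lemma dot_ge0 x : 0 <= dot x x.
Proof. by rewrite dotE sumr_ge0// => j _; rewrite -expr2 sqr_ge0. Qed.

Lemma dot_gt0 x : x != 0 -> 0 < dot x x.
Proof.
apply: contraNT; rewrite -leNgt => x0; apply/eqP/rowP => j; rewrite mxE.
have : x ord0 j * x ord0 j <= 0.
  apply: le_trans x0; rewrite dotE (bigD1 j)//= lerDl sumr_ge0// => i _.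
  by rewrite -expr2 sqr_ge0.
by rewrite -expr2 real_exprn_even_le0//= ?num_real// => /eqP.
Qed.

Lemma dot_delta j x : dot (delta_mx ord0 j) x = x ord0 j.
Proof.
rewrite dotE (bigD1 j)//= mxE !eqxx mul1r big1 ?addr0// => i ij.
by rewrite mxE (negbTE ij) andbF mul0r.
Qed.

Lemma normr_dot_le u x (r : R) : (forall j, `|x ord0 j| <= r) ->
  `|dot u x| <= (\sum_j `|u ord0 j|) * r.
Proof.
move=> xr; rewrite dotE mulr_suml (le_trans (ler_norm_sum _ _ _))//.
by apply: ler_sum => j _; rewrite normrM ler_wpM2l.
Qed.

(** Adding to [x] any [z] orthogonal to [u] stays in the hyperplane, so [v] vanishes on the
    orthogonal complement of [u] and equals its projection onto [u]. *)
Lemma hyperplane_normal u v (a b : R) x : v != 0 -> hyperplane u a x ->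
  hyperplane v b = hyperplane u a -> u != 0 ->
  exists2 t, t != 0 & v = t *: u.
Proof.
move=> v0 ux vu u0; have uu := dot_gt0 u u0.
have vx : dot v x = b by change (hyperplane v b x); rewrite vu.
have orth z : dot u z = 0 -> dot v z = 0.
  move=> uz; have : hyperplane v b (x + z).
    by rewrite vu /hyperplane /= dotDr uz addr0.
  by rewrite /hyperplane /= dotDr vx; lra.
have vtu : v = (dot v u / dot u u) *: u.
  apply/rowP => j; rewrite mxE -!dot_delta; set w := delta_mx ord0 j.
  have /orth : dot u (w - (dot u w / dot u u) *: u) = 0.
    by rewrite dotBr dotZr divfK ?gt_eqF// subrr.
  rewrite dotBr dotZr => /subr0_eq; rewrite (dotC w v) (dotC w u) => ->.
  by rewrite mulrC mulrA mulrAC.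
exists (dot v u / dot u u) => //; apply: contraNN v0 => /eqP t0.
by rewrite vtu t0 scale0r.
Qed.

End Dot.

(** * Antipodality through linear forms *)

Section Antipodal.
Context {R : realType} {d : nat}.
Local Notation V := 'rV[R]_d.
Implicit Types (u x y : V) (X : {fset V}).

(** The strict inequality keeps the two supporting hyperplanes distinct and forces [u] to be
    nonzero. *)
Definition separates_as u X x y :=
  dot u y < dot u x /\ forall p, p \in X -> dot u y <= dot u p <= dot u x.

Definition antipodal X x y := exists u, separates_as u X x y.

Lemma convex_halfspace u (c : R) : convex_set [set x : V | dot u x <= c].
Proof.
move=> x y l; rewrite !inE /= => xc yc; rewrite dotDr !dotZr.
have l0 : 0 <= l%:num by [].
have l1 : l%:num <= 1 by [].
rewrite [leRHS](_ : c = l%:num * c + (1 - l%:num) * c); last by ring.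
by rewrite lerD// ler_wpM2l// subr_ge0.
Qed.

Lemma supporting_hyperplane X u x : u != 0 -> x \in X ->
  (forall p, p \in X -> dot u p <= dot u x) ->
  supporting (conv_hull [set` X]) (hyperplane u (dot u x)).
Proof.
move=> u0 xX ux; split.
  by exists x; split=> //; apply: sub_gen_smallest.
exists u, (dot u x); split=> //; apply: smallest_sub => //.
exact: convex_halfspace.
Qed.

Lemma antipodalP X x y : x \in X -> y \in X ->
  antipodal X x y <->
  exists H1 H2, [/\ supporting (conv_hull [set` X]) H1,
                    supporting (conv_hull [set` X]) H2,
                    parallel H1 H2 /\ H1 <> H2, H1 x & H2 y].
Proof.
move=> xX yX; split=> [[u [yx uX]]|].
  have u0 : u != 0.
    by apply: contraTneq yx => ->; rewrite dotC dot0r dotC dot0r ltxx.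
  exists (hyperplane u (dot u x)), (hyperplane u (dot u y)); split=> //.
  - by apply: supporting_hyperplane => // p /uX /andP[].
  - have -> : hyperplane u (dot u y) = hyperplane (- u) (dot (- u) y).
      apply/seteqP; split=> z; rewrite /hyperplane/= !dotNl; first by move->.
      exact: oppr_inj.
    apply: supporting_hyperplane; rewrite ?oppr_eq0// => p /uX /andP[up _].
    by rewrite !dotNl lerN2.
  - split; first by exists u, (dot u x), (dot u y).
    by move=> /seteqP[/(_ x erefl)/= xy _]; rewrite /hyperplane/= in xy; lra.
move=> [H1 [H2 [[_ [u1 [c1 [u10 H1E C1]]]] [_ [u2 [c2 [u20 H2E C2]]]]
  [[u [a [b [u0 Ha Hb]]]] H12] H1x H2y]]].
have X1 p : p \in X -> dot u1 p <= c1.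
  by move=> pX; apply: C1; apply: sub_gen_smallest.
have X2 p : p \in X -> dot u2 p <= c2.
  by move=> pX; apply: C2; apply: sub_gen_smallest.
have ua : hyperplane u a x by rewrite -Ha.
have ub : hyperplane u b y by rewrite -Hb.
have [t1 t10 u1E] := hyperplane_normal u u1 a c1 x u10 ua (etrans (esym H1E) Ha)
  u0.
have [t2 t20 u2E] := hyperplane_normal u u2 b c2 y u20 ub (etrans (esym H2E) Hb)
  u0.
have c1E : c1 = t1 * a.
  by rewrite H1E in H1x; rewrite -H1x u1E dotZl ua.
have c2E : c2 = t2 * b.
  by rewrite H2E in H2y; rewrite -H2y u2E dotZl ub.
have ab : a != b by apply: contra_not_neq H12 => ab; rewrite Ha Hb ab.
have {}X1 p : p \in X -> t1 * dot u p <= t1 * a.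
  by move=> /X1; rewrite u1E dotZl c1E.
have {}X2 p : p \in X -> t2 * dot u p <= t2 * b.
  by move=> /X2; rewrite u2E dotZl c2E.
rewrite /hyperplane/= in ua ub.
have := X1 _ yX; have := X2 _ xX; rewrite ua ub.
(* The half-space conditions and [a != b] force [t1] and [t2] to have opposite signs; the sign of
   [t1] decides whether [u] or [- u] separates. *)
have [t1lt|t1gt|/eqP] := ltrgtP t1 0; last by rewrite (negbTE t10).
- rewrite (ler_nM2l t1lt) => ba ab'.
  have {ab'}ltab : a < b by rewrite lt_neqAle ab.
  have [t2lt|t2gt|/eqP] := ltrgtP t2 0; last by rewrite (negbTE t20).
    by move: ba; rewrite (ler_nM2l t2lt) leNgt ltab.
  exists (- u); split=> [|p pX]; rewrite !dotNl ?ua ?ub ?ltrN2// !lerN2.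
  by rewrite -(ler_pM2l t2gt) X2//= -(ler_nM2l t1lt) X1.
- rewrite (ler_pM2l t1gt) => ba ab'.
  have {ab'}ltba : b < a by rewrite lt_neqAle eq_sym ab.
  have [t2lt|t2gt|/eqP] := ltrgtP t2 0; last by rewrite (negbTE t20).
    exists u; split=> [|p pX]; rewrite ua ub//.
    by rewrite -(ler_nM2l t2lt) X2//= -(ler_pM2l t1gt) X1.
  by move: ba; rewrite (ler_pM2l t2gt) leNgt ltba.
Qed.

Lemma k_antipodalP k X : k_antipodal k X <->
  forall Y, (Y `<=` X)%fset -> #|` Y| = k ->
    exists x y, [/\ x \in Y, y \in Y & antipodal X x y].
Proof.
split=> kX Y YX Yk; have [x [y]] := kX Y YX Yk.
  move=> [xY yY xy H]; exists x, y; split=> //.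
  by apply/antipodalP => //; apply: (fsubsetP YX).
move=> [xY yY xy]; exists x, y; split=> //.
  by case: xy => u [uyx _]; apply: contraTneq uyx => ->; rewrite ltxx.
by apply/antipodalP => //; apply: (fsubsetP YX).
Qed.

End Antipodal.

(** * Counting homothetic copies in place of volumes *)

Lemma leq_expn_bound (a b C : nat) :
  (forall n, a ^ n <= C * b ^ n)%N -> (a <= b)%N.
Proof.
move=> abC; rewrite leqNgt; apply/negP => ba.
(* Bernoulli's inequality for [a / b], cleared of denominators; at [n = b * C] it contradicts the
   hypothesis. *)
have bern n : ((b + n) * b ^ n <= b * a ^ n)%N.
  elim: n => [|n IH]; first by rewrite addn0.
  rewrite !expnS; apply: (@leq_trans ((b + n) * b ^ n * b.+1)); first by nia.
  by rewrite mulnCA (mulnC a) leq_mul.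
have [b0|b0] := posnP b.
  by have := abC 1%N; rewrite b0 !expn1 muln0 leqNgt (leq_ltn_trans _ ba).
have := bern (b * C)%N; have := abC (b * C)%N.
have := expn_gt0 b (b * C); rewrite b0 /=.
move: (b ^ _)%N (a ^ _)%N => B A B0 AC.
rewrite -{1}(muln1 b) -mulnDr -mulnA leq_pmul2l// => /leq_trans/(_ AC).
by rewrite leq_mul2r; lia.
Qed.

Section Homotheties.
Context {R : realType} {d : nat}.
Local Notation V := 'rV[R]_d.
Implicit Types (a b p q : V) (l : seq V) (s : R) (U : set V).

(** Membership of [p] in [a + s^-1 U], as a boolean so that [count] gives the covering
    multiplicity. *)
Definition in_copy U s p a : bool := `[< U (s *: (p - a)) >].

(** Translation parts of the [n]-fold compositions of the maps [q |-> a + s^-1 q], all of ratio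
    [s^-n]. A list counts coinciding compositions separately. *)
Fixpoint words s l n : seq V :=
  if n is n'.+1 then [seq a + s^-1 *: b | a <- l, b <- words s l n']
  else [:: 0].

Lemma size_words s l n : size (words s l n) = (size l ^ n)%N.
Proof. by elim: n => //= n IH; rewrite size_allpairs IH expnS. Qed.

Definition stable U s l := forall a q, a \in l -> U q -> U (a + s^-1 *: q).

Lemma stable_words U s l n : s != 0 -> stable U s l ->
  stable U (s ^+ n) (words s l n).
Proof.
move=> s0 Ul; elim: n => [|n IH] a q /=.
  by rewrite inE => /eqP ->; rewrite add0r expr0 invr1 scale1r.
move=> /allpairsP[[b c] /= [bl cw ->]] Uq.
rewrite exprS invfM -scalerA -addrA -scalerDr; apply: Ul => //.
exact: IH.
Qed.

(** [s *: (p - a)] is the preimage of [p] under the first map of the word. *)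
Lemma in_copy_word U s n p a b : s != 0 ->
  in_copy U (s ^+ n.+1) p (a + s^-1 *: b) =
  in_copy U (s ^+ n) (s *: (p - a)) b.
Proof.
move=> s0; rewrite /in_copy; congr `[< U _ >].
rewrite exprSr -scalerA; congr (_ *: _).
by rewrite opprD addrA scalerBr scalerA divff// scale1r.
Qed.

Lemma stableE U s l p a : s != 0 -> stable U s l -> a \in l ->
  in_copy U s p a -> U p.
Proof.
move=> s0 Ul al /asboolP /(Ul a _ al).
by rewrite scalerA mulVf// scale1r addrCA subrr addr0.
Qed.

Lemma count_wordsS U s l n p : s != 0 ->
  count (in_copy U (s ^+ n.+1) p) (words s l n.+1) =
  (\sum_(a <- l) count (in_copy U (s ^+ n) (s *: (p - a))) (words s l n))%N.
Proof.
move=> s0 /=; elim: l (words s l n) => [|a l IH] w /=; first by rewrite big_nil.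
rewrite count_cat IH big_cons; congr addn.
rewrite count_map; apply: eq_count => b /=; exact: in_copy_word.
Qed.

Lemma count_words_out U s l n q : s != 0 -> stable U s l -> ~ U q ->
  count (in_copy U (s ^+ n) q) (words s l n) = 0%N.
Proof.
move=> s0 Ul Uq; apply/eqP; rewrite eqn0Ngt -has_count; apply/hasPn => b bw.
apply/negP => /(stableE _ _ _ _ _ _ (stable_words _ _ _ n s0 Ul) bw).
by rewrite expf_neq0// => /(_ isT).
Qed.

(** At most [M] first letters have a copy containing [p]. By stability the others contribute
    nothing, and each of these leaves at most [M ^ n] continuations. *)
Lemma count_words U s l M : s != 0 -> stable U s l ->
  (forall p, count (in_copy U s p) l <= M)%N ->
  forall n p, (count (in_copy U (s ^+ n) p) (words s l n) <= M ^ n)%N.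
Proof.
move=> s0 Ul lM; elim=> [|n IH] p; first by rewrite /= addn0 expn0 leq_b1.
rewrite count_wordsS// expnS.
apply: (@leq_trans (\sum_(a <- l) in_copy U s p a * M ^ n)).
  apply: leq_sum => a _; case: (boolP (in_copy U s p a)) => [_|/asboolPn Ua].
    by rewrite mul1n.
  by rewrite count_words_out.
rewrite -big_distrl/= leq_mul2r; apply/orP; right; apply: leq_trans (lM p).
by rewrite -sum1_count [leqRHS]big_mkcond/=; apply: leq_sum => a _;
  case: in_copy.
Qed.

Definition grid (B e : R) N (c : {ffun 'I_d -> 'I_N}) : V :=
  \row_j (- B + (c j)%:R * e).

Lemma gridP (B e : R) N q : 0 < e -> B + B < N%:R * e ->
  (forall j, `|q ord0 j| <= B) ->
  exists c : {ffun 'I_d -> 'I_N},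
    forall j, `|grid B e N c ord0 j - q ord0 j| <= e.
Proof.
move=> e0 BN qB.
have qj j : 0 <= (q ord0 j + B) / e < N%:R.
  rewrite divr_ge0 ?(ltW e0)//=; last by have := qB j; rewrite ler_norml; lra.
  rewrite ltr_pdivrMr//; have := qB j; rewrite ler_norml; lra.
have cj j : (Num.truncn ((q ord0 j + B) / e) < N)%N.
  have /andP[q0 qN] := qj j.
  by rewrite -(ltr_nat R) (le_lt_trans _ qN)// truncn_le.
exists [ffun j => Ordinal (cj j)] => j; rewrite mxE ffunE /=.
have /andP[q0 qN] := qj j; have /andP[] := truncn_itv q0.
set t := Num.truncn _; rewrite ler_pdivlMr// ltr_pdivrMr// -natr1 => t1 t2.
rewrite ler_norml; lra.
Qed.

(* Comparing volumes: the [size l] copies of [U] scaled by [1/s] lie in [U] and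
   cover each point at most [M] times.  Instead of a measure, the [n]-fold
   compositions are counted against a grid of mesh proportional to [s^-n]; the
   constants disappear as [n] grows. *)
Lemma size_copies U (s : nat) l M (B r : R) p0 :
  (0 < s)%N -> 0 < r -> (forall q, (forall j, `|q ord0 j - p0 ord0 j| <= r) -> U
    q) ->
  (forall q j, U q -> `|q ord0 j| <= B) ->
  stable U s%:R l ->
  (forall p, count (in_copy U s%:R p) l <= M)%N ->
  (size l <= M * s ^ d)%N.
Proof.
move=> s0 r0 Ur UB Ul lM; set S : R := s%:R.
have S0 : 0 < S by rewrite ltr0n.
have Sn0 n : 0 < S ^+ n by rewrite exprn_gt0.
have [N BN] : exists N : nat, B + B < N%:R * r.
  exists (Num.truncn ((B + B) / r)).+1.
  by rewrite -ltr_pdivrMr// truncnS_gt.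
(* [N] was chosen from [B] and [r] alone, so [N ^ d] stays constant as [n] varies. *)
apply: (@leq_expn_bound _ _ (N ^ d)) => n.
(* The cube of half-side [r] about [p0] shrinks to half-side [e] in each [n]-fold copy, so a grid of
   mesh [e] meets every copy. *)
pose e := r / S ^+ n.
have e0 : 0 < e by rewrite divr_gt0.
pose T := {ffun 'I_d -> 'I_(N * s ^ n)}.
have near a : a \in words S l n -> exists c : T, in_copy U (S ^+ n) (grid B e _
  c) a.
  move=> aw; have Up : U p0 by apply: Ur => j; rewrite subrr normr0 ltW.
  have Uq := stable_words _ _ _ n (lt0r_neq0 S0) Ul _ _ aw Up.
  have [|c qc] := gridP B e (N * s ^ n) _ e0 _ (fun j => UB _ j Uq).
    by rewrite natrM natrX /e mulrA mulrAC mulfK ?gt_eqF.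
  exists c; apply/asboolP; apply: Ur => j.
  have := qc j; rewrite /e ler_pdivlMr//; congr (_ <= _).
  rewrite -[X in _ * X](gtr0_norm (Sn0 n)) -normrM; congr `|_|.
  move: (grid _ _ _ _) => g; rewrite !mxE; move: (Sn0 n) => /lt0r_neq0 Sn;
    field; exact: Sn.
(* Double counting: every word has a grid point in its copy, and below every grid point is shown to
   lie in at most [M ^ n] copies. *)
have sizew : (size l ^ n <= \sum_(c : T) count (in_copy U (S ^+ n) (grid B e _
  c)) (words S l n))%N.
  rewrite -(size_words S) -sum1_size.
  under [leqRHS]eq_bigr do rewrite -sum1_count big_mkcond/=.
  rewrite exchange_big/= !big_seq; apply: leq_sum => a /near[c ca].
  by rewrite (bigD1 c)//= ca.
apply: (leq_trans sizew).
apply: (@leq_trans (\sum_(c : T) M ^ n)).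
  by apply: leq_sum => c _; apply: count_words => //; rewrite gt_eqF.
by rewrite sum_nat_const card_ffun !card_ord !expnMn -!expnM (mulnC n) -mulnA
  (mulnC (M ^ n)%N).
Qed.

End Homotheties.

(** * Open polytopes adapted to a point set *)

Section Polytope.
Context {R : realType} {d : nat}.
Local Notation V := 'rV[R]_d.
Implicit Types (u v x y p q : V) (X : {fset V}) (H : seq (V * R)).

Lemma dot_sumr u (I : Type) (s : seq I) (F : I -> V) :
  dot u (\sum_(i <- s) F i) = \sum_(i <- s) dot u (F i).
Proof. exact: (big_morph (dot u) (dotDr u) (dot0r u)). Qed.

Definition polytope H : set V := [set p | forall h, h \in H -> dot h.1 p < h.2].

Lemma polytope_nbhs H p : polytope H p ->
  exists2 r, 0 < r & forall q, (forall j, `|q ord0 j - p ord0 j| <= r) ->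
    polytope H q.
Proof.
elim: H => [|[u c] H IH] Hp; first by exists 1.
have [|r r0 Hr] := IH; first by move=> h hH; apply: Hp; rewrite inE hH orbT.
have upc : dot u p < c by apply: (Hp (u, c)); rewrite inE eqxx.
set D := c - dot u p; have D0 : 0 < D by rewrite subr_gt0.
set S := \sum_j `|u ord0 j|; have S0 : 0 <= S by rewrite sumr_ge0.
have S1 : 0 < S + 1 by rewrite ltr_pwDr.
exists (Num.min r (D / (S + 1))); first by rewrite lt_min r0 divr_gt0.
move=> q qr h; rewrite inE => /orP[/eqP -> /=|]; last first.
  by apply: Hr => j; rewrite (le_trans (qr j))// ge_min lexx.
have /(normr_dot_le u (q - p)) : forall j, `|(q - p) ord0 j| <= D / (S + 1).
  by move=> j; rewrite !mxE (le_trans (qr j))// ge_min lexx orbT.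
rewrite -/S dotBr ler_norml => /andP[_].
have : D / (S + 1) * (S + 1) = D by rewrite divfK ?gt_eqF.
have : 0 < D / (S + 1) by rewrite divr_gt0.
by rewrite {3}/D; move: (D / _) => t; lra.
Qed.

(** The midpoint of a point satisfying a constraint weakly and one satisfying it strictly satisfies
    it strictly. *)
Lemma polytope_stable H X : 
  (forall h x, h \in H -> x \in X -> dot h.1 x <= h.2) ->
  stable (polytope H) 2 [seq 2^-1 *: x | x <- X].
Proof.
move=> HX _ q /mapP[x xX ->] Hq h hH.
rewrite dotDr !dotZr; have := Hq h hH; have := HX h x hH xX; lra.
Qed.

(** Averaging over [X] a constraint that holds weakly everywhere and strictly somewhere gives a
    strict one. *)
Lemma polytope_centroid H X : X != fset0 ->
  (forall h x, h \in H -> x \in X -> dot h.1 x <= h.2) ->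
  (forall h, h \in H -> exists2 x, x \in X & dot h.1 x < h.2) ->
  polytope H (#|` X|%:R^-1 *: \sum_(x <- X) x).
Proof.
move=> X0 HX Hlt h hH; have [x xX hx] := Hlt h hH.
rewrite dotZr dot_sumr mulrC ltr_pdivrMr ?ltr0n ?cardfs_gt0//.
have -> : h.2 * #|` X|%:R = \sum_(y <- X) h.2.
  by rewrite big_const_seq count_predT iter_addr_0 mulr_natr.
rewrite -subr_gt0 -sumrB (bigD1_seq x) ?fset_uniq//= ltr_pwDl ?subr_gt0//.
rewrite big_seq_cond sumr_ge0// => y /andP[yX _].
by rewrite subr_ge0 HX.
Qed.

Lemma seq_gap (T : eqType) (s : seq T) (f : T -> R) :
  (forall i, i \in s -> 0 < f i) ->
  exists2 e, 0 < e & forall i, i \in s -> e < f i.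
Proof.
elim: s => [|a s IH] fs; first by exists 1.
have [|e e0 es] := IH; first by move=> i si; apply: fs; rewrite inE si orbT.
have fa : 0 < f a by rewrite fs// inE eqxx.
exists (Num.min e (f a / 2)); first by rewrite lt_min e0 divr_gt0.
move=> i; rewrite inE gt_min => /orP[/eqP ->|/es ->//].
by apply/orP; right; lra.
Qed.

(* The slab conditions keep the half-size copies of [U] at antipodal points
   disjoint; the box makes [U] bounded even when [X] lies in a hyperplane. *)
Lemma antipodal_polytope X v c : v \in X ->
  (forall x, x \in X -> dot v x < c) ->
  exists U : set V,
  [/\ exists p r, 0 < r /\
        forall q, (forall j, `|q ord0 j - p ord0 j| <= r) -> U q,
      exists B, forall q j, U q -> `|q ord0 j| <= B,
      stable U 2 [seq 2^-1 *: x | x <- X],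
      forall x y p, x \in X -> y \in X -> antipodal X x y ->
        U (2 *: p - x) -> ~ U (2 *: p - y) &
      forall q, U q -> dot v q < c].
Proof.
move=> vX vc.
(* The default form 0 never matters: [w] is used on antipodal pairs only. *)
pose w z := xget 0 [set u | separates_as u X z.1 z.2].
have wP z : antipodal X z.1 z.2 -> separates_as (w z) X z.1 z.2.
  exact: xgetPex.
pose pairs := [seq z <- [seq (x, y) | x <- X, y <- X] | `[< antipodal X z.1 z.2
  >]].
have pairsP x y : x \in X -> y \in X -> antipodal X x y -> (x, y) \in pairs.
  move=> xX yX xy; rewrite mem_filter; apply/andP; split; first exact/asboolP.
  by apply/allpairsP; exists (x, y).
have pairsE z : z \in pairs -> [/\ z.1 \in X, z.2 \in X & antipodal X z.1 z.2].
  rewrite mem_filter => /andP[/asboolP zX /allpairsP[[x y] /= [xX yX zE]]].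
  by rewrite zE in zX *.
pose B := 1 + \sum_(x <- X) \sum_j `|x ord0 j|.
have XB x j : x \in X -> `|x ord0 j| < B.
  move=> xX; rewrite /B (bigD1_seq x) ?fset_uniq//= (bigD1 j)//=.
  have : 0 <= \sum_(i < d | i != j) `|x ord0 i| by rewrite sumr_ge0.
  have : 0 <= \sum_(y <- X | y != x) \sum_j `|y ord0 j|.
    by rewrite sumr_ge0// => y _; rewrite sumr_ge0.
  by lra.
pose e j : V := delta_mx ord0 j.
pose H := (v, c) :: [seq (w z, dot (w z) z.1) | z <- pairs] ++
  [seq (- w z, - dot (w z) z.2) | z <- pairs] ++
  [seq (e j, B) | j <- enum 'I_d] ++ [seq (- e j, B) | j <- enum 'I_d].
(* Weak validity on [X] gives stability; strictness at one point puts the centroid inside. *)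
have XH h : h \in H -> (forall x, x \in X -> dot h.1 x <= h.2) /\
                      (exists2 x, x \in X & dot h.1 x < h.2).
  rewrite inE !mem_cat => /orP[/eqP ->|/orP[|/orP[|/orP[]]]].
  - by split=> [x /vc/ltW|]//; exists v => //; apply: vc.
  - case/mapP => z /pairsE[z1 z2 /wP[z12 zX]] -> /=; split; last by exists z.2.
    by move=> x /zX /andP[].
  - case/mapP => z /pairsE[z1 z2 /wP[z12 zX]] -> /=; split.
      by move=> x /zX /andP[]; rewrite dotNl lerN2.
    by exists z.1 => //; rewrite dotNl ltrN2.
  - case/mapP => j _ -> /=; split=> [x xX|]; last exists v => //;
      rewrite dot_delta; last exact: le_lt_trans (ler_norm _) (XB _ _ vX).
    by apply: le_trans (ler_norm _) (ltW (XB _ _ xX)).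
  - case/mapP => j _ -> /=; split=> [x xX|]; last exists v => //;
      rewrite dotNl dot_delta -?normrN;
      last by apply: le_lt_trans (ler_norm _) _; rewrite normrN XB.
    by apply: le_trans (ler_norm _) _; rewrite normrN ltW// XB.
have HP q h1 h2 : polytope H q -> (h1, h2) \in H -> dot h1 q < h2.
  by move=> Hq /Hq.
have HXpos q z : polytope H q -> z \in pairs ->
    dot (w z) z.2 < dot (w z) q < dot (w z) z.1.
  move=> Hq zp; apply/andP; split.
    rewrite -ltrN2 -dotNl; apply: HP Hq _; rewrite inE !mem_cat.
    by rewrite (map_f (fun z => (- w z, - dot (w z) z.2)) zp) !orbT.
  apply: HP Hq _; rewrite inE !mem_cat.
  by rewrite (map_f (fun z => (w z, dot (w z) z.1)) zp) !orbT.
exists (polytope H); split.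
- exists (#|` X|%:R^-1 *: \sum_(x <- X) x).
  have [] := polytope_nbhs H (#|` X|%:R^-1 *: \sum_(x <- X) x).
    apply: polytope_centroid; first by apply/fset0Pn; exists v.
      by move=> h x /XH[+ _]; apply.
    by move=> h /XH[].
  by move=> r r0 Hr; exists r.
- exists B => q j Hq; rewrite ler_norml -lerNl -dot_delta -dotNl.
  apply/andP; split; apply/ltW; apply: HP Hq _; rewrite inE !mem_cat.
    by rewrite (map_f (fun j => (- e j, B)) (mem_enum _ j)) !orbT.
  by rewrite (map_f (fun j => (e j, B)) (mem_enum _ j)) !orbT.
- by apply: polytope_stable => h x /XH[+ _]; apply.
(* For the form of the pair, the slab bounds at [2 *: p - x] and [2 *: p - y] put its value at
   [2 *: p] strictly above and strictly below its value at [x + y]. *)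
- move=> x y p xX yX xy Hx Hy; have zp := pairsP x y xX yX xy.
  have /andP[+ _] := HXpos _ _ Hx zp; have /andP[_ +] := HXpos _ _ Hy zp.
  by rewrite /= !dotBr; lra.
- by move=> q Hq; apply: HP Hq _; rewrite inE eqxx.
Qed.

End Polytope.

(** * Upper bounds on the cardinality *)

Section UpperBound.
Context {R : realType} {d : nat}.
Local Notation V := 'rV[R]_d.
Implicit Types (u v x y p q : V) (X : {fset V}) (U : set V).

(** A point in [k] half-size copies would give [k] points of [X], two of them antipodal and hence
    with disjoint copies. *)
Lemma count_half_copies k X U : (0 < k)%N -> k_antipodal k X ->
  (forall x y p, x \in X -> y \in X -> antipodal X x y ->
     U (2 *: p - x) -> ~ U (2 *: p - y)) ->
  forall p, (count (in_copy U 2 p) [seq 2^-1 *: x | x <- X] <= k - 1)%N.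
Proof.
move=> k0 /k_antipodalP kX UX p; rewrite -ltnS subn1 prednK//.
rewrite ltnNge; apply/negP => kc;
  pose F := [seq x <- X | `[< U (2 *: p - x) >]].
have FE x : x \in F -> x \in X /\ U (2 *: p - x).
  by rewrite mem_filter => /andP[/asboolP].
have uF : uniq F by rewrite filter_uniq// fset_uniq.
have kF : (k <= size F)%N.
  rewrite size_filter; apply: leq_trans kc _; rewrite count_map.
  apply: eq_leq; apply: eq_count => x /=; rewrite /in_copy scalerBr scalerA.
  by rewrite mulfV ?scale1r// pnatr_eq0.
pose Y := [fset x in take k F]%fset.
have YF x : x \in Y -> x \in F by rewrite inE => /mem_take.
have [||x [y [xY yY xy]]] := kX Y.
- by apply/fsubsetP => x /YF /FE[].
- by rewrite card_fseq undup_id ?take_uniq// size_takel.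
have [xX Ux] := FE _ (YF _ xY); have [yX Uy] := FE _ (YF _ yY).
exact: UX xX yX xy Ux Uy.
Qed.

Lemma card_k_antipodal k X : (0 < k)%N -> k_antipodal k X ->
  (#|` X| <= (k - 1) * 2 ^ d)%N.
Proof.
move=> k0 kX; have [->|/fset0Pn[z zX]] := eqVneq X fset0;
  first by rewrite cardfs0.
have [c vc] : exists c, forall x, x \in X -> dot z x < c.
  exists (1 + \sum_(x <- X) `|dot z x|) => x xX.
  rewrite (bigD1_seq x) ?fset_uniq//=.
  have : 0 <= \sum_(i <- X | i != x) `|dot z i| by rewrite sumr_ge0.
  by have := ler_norm (dot z x); lra.
have [U [[p0 [r [r0 Ur]]] [B UB] Us Ud _]] := antipodal_polytope X z c zX vc.
rewrite -(size_map ( *:%R 2^-1)); apply: (size_copies U 2 _ _ B r p0) => //.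
exact: count_half_copies.
Qed.

(** A point [v] of [X] farthest from the origin is exposed by [v] itself: expand the positive square
    of [x - v]. *)
Lemma exists_exposed X : X != fset0 -> exists2 v, v \in X &
  forall x, x \in X -> x != v -> dot v x < dot v v.
Proof.
move=> X0; have [v vX vmax] : exists2 v, v \in X & forall x, x \in X -> dot x x
  <= dot v v.
  have /fset0Pn[z zX] := X0.
  pose f (i : X) := dot (val i) (val i).
  have [i _ imax] := @arg_maxP _ _ X [` zX]%fset xpredT f isT.
  by exists (val i); [exact: valP | move=> x xX; exact: (imax [` xX]%fset isT)].
exists v => // x xX xv; have := vmax x xX.
have : 0 < dot (x - v) (x - v) by rewrite dot_gt0// subr_eq0.
by rewrite dotBr !dotDl !dotNl (dotC x v); lra.
Qed.

(** The word with all letters [2^-1 *: v]; the coefficient is the geometric sum of the first [m]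
    powers of 1/2. *)
Lemma repeated_word v X m : v \in X ->
  (1 - (2 ^+ m)^-1) *: v \in words (2 : R) [seq 2^-1 *: x | x <- X] m.
Proof.
move=> vX; elim: m => [|m IH] /=;
  first by rewrite expr0 invr1 subrr scale0r inE.
apply/allpairsP; exists (2^-1 *: v, (1 - (2 ^+ m)^-1) *: v); split => //=.
  exact: map_f.
by rewrite scalerA -scalerDl exprS invfM; congr (_ *: _); field;
  rewrite expf_neq0.
Qed.

(* Near an exposed point [v] the only half-size copy of [U] is the one at [v],
   so the [m]-fold copy at [v] can be counted once more without exceeding the
   multiplicity [(k - 1) ^ m]. *)
Lemma card_k_antipodal_lt k X : (3 <= k)%N -> k_antipodal k X ->
  (#|` X| < (k - 1) * 2 ^ d)%N.
Proof.
move=> k3 kX; have k0 : (0 < k)%N by apply: leq_trans k3.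
have [->|X0] := eqVneq X fset0.
  by rewrite cardfs0 muln_gt0 subn_gt0 expn_gt0 (leq_trans _ k3).
have [v vX vexp] := exists_exposed X X0.
pose s := [seq x <- X | x != v].
(* With [dot v q < dot v v + e] on [U], this [e] puts the half-size copy at any [x != v] inside
   [dot v p < dot v v - e / 2]. *)
have [e e0 es] : exists2 e, 0 < e & forall x, x \in s -> e < (dot v v - dot v x)
  / 2.
  apply: seq_gap => x; rewrite mem_filter => /andP[xv xX].
  by rewrite divr_gt0// subr_gt0 vexp.
have vc x : x \in X -> dot v x < dot v v + e.
  move=> xX; have [->|/vexp-/(_ xX)] := eqVneq x v; lra.
have [U [[p0 [r [r0 Ur]]] [B UB] Us Ud Uc]] := antipodal_polytope X v _ vX vc.
set l := [seq 2^-1 *: x | x <- X] in Us.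
have lk := count_half_copies k X U k0 kX Ud.
have two0 : (2 : R) != 0 by rewrite pnatr_eq0.
pose C := (\sum_j `|v ord0 j|) * B.
(* Large enough for the [m]-fold copy at [v] to lie in [dot v p >= dot v v - e / 2]. *)
have [m m0 mC] : exists2 m, (0 < m)%N & 2 * (dot v v + C) <= 2 ^+ m * e.
  exists (Num.truncn (2 * (dot v v + C) / e)).+1 => //.
  rewrite -ler_pdivrMr//; apply: ltW; apply: lt_trans (truncnS_gt _) _.
  by rewrite -natrX ltr_nat ltn_expl.
pose a := (1 - (2 ^+ m)^-1) *: v.
have aw : a \in words 2 l m by exact: repeated_word.
have alone x p : U ((2 ^+ m) *: (p - a)) -> x \in X -> x != v -> ~ U (2 *: p -
  x).
  move=> Ua xX xv /Uc; rewrite dotBr dotZr.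
  have : e < (dot v v - dot v x) / 2 by apply: es; rewrite mem_filter xv.
  have : `|dot v ((2 ^+ m) *: (p - a))| <= C.
    by apply: normr_dot_le => j; apply: UB.
  rewrite dotZr dotBr dotZr ler_norml => /andP[+ _].
  have := mC; have : 0 < 2 ^+ m :> R by rewrite exprn_gt0.
  move: (2 ^+ m : R) => t t0 tC H1 H2 H3.
  have : dot v p - dot v v < - e / 2 by lra.
  rewrite -(ltr_pM2l t0); move: H1.
  rewrite (_ : t * _ = t * (dot v p - dot v v) + dot v v); first by lra.
  by field; rewrite gt_eqF.
have cnt p : (count (in_copy U (2 ^+ m) p) (a :: words 2 l m) <= (k - 1) ^ m)%N.
  rewrite /=; case: (boolP (in_copy _ _ _ a)) => [/asboolP Ua|_]; last first.
    by rewrite add0n; apply: count_words.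
  (* With length [m.+1], only words starting at [v] remain: at most [(k - 1) ^ m] of them, and one
     more fits under [(k - 1) ^ m.+1] because [k - 1 >= 2]. *)
  case: m m0 a aw mC alone Ua => // m _ a aw mC alone Ua.
  rewrite count_wordsS// /l big_map (bigD1_seq v) ?fset_uniq//=.
  rewrite [X in (_ + (_ + X))%N]big1_seq ?addn0; last first.
    move=> x /andP[xv xX]; apply: count_words_out => //.
    by rewrite scalerBr scalerA divff// scale1r; apply: alone.
  have := count_words U 2 l (k - 1) two0 Us lk m (2 *: (p - 2^-1 *: v)).
  have : (0 < (k - 1) ^ m)%N by rewrite expn_gt0 subn_gt0 (leq_trans _ k3).
  rewrite expnS; move: (count _ _) ((k - 1) ^ m)%N => n M; nia.
have st : stable U (2 ^ m)%:R (a :: words 2 l m).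
  rewrite natrX => b q; rewrite inE => /orP[/eqP -> |bw].
    exact: (stable_words U 2 l m two0 Us a q aw).
  exact: (stable_words U 2 l m two0 Us b q bw).
(* The list has [1 + #|X| ^ m] entries, so [#|X| ^ m] is strictly below the [m]-th power of
   [(k - 1) * 2 ^ d]. *)
have := size_copies U (2 ^ m) _ ((k - 1) ^ m) B r p0 _ r0 Ur UB st.
rewrite natrX expn_gt0 => /(_ isT cnt) /=.
by rewrite size_words size_map (expnAC 2) -expnMn ltn_exp2r.
Qed.

End UpperBound.

(** * Convex bodies, gauges and polar forms *)

Section ConvexBody.
Context {R : realType} {d : nat}.
Local Notation V := 'rV[R]_d.
Implicit Types (u w x y z p q : V) (X : {fset V}) (K : set V).

Lemma continuous_dot u : continuous (dot u : V -> R).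
Proof.
have -> : dot u = fun x => \sum_j u ord0 j * x ord0 j by apply/funext => x;
  exact: dotE.
apply: (continuous_big (op := +%R)); first exact: add_continuous.
by move=> j _ x; apply: continuousM;
  [exact: cst_continuous | exact: coord_continuous].
Qed.

Lemma continuous_sqdist q : continuous (fun z : V => dot (q - z) (q - z)).
Proof.
have -> : (fun z : V => dot (q - z) (q - z)) =
          fun z => \sum_j (q ord0 j - z ord0 j) * (q ord0 j - z ord0 j).
  by apply/funext => z; rewrite dotE; apply: eq_bigr => j _; rewrite !mxE.
apply: (continuous_big (op := +%R)); first exact: add_continuous.
have c j : continuous (fun z : V => q ord0 j - z ord0 j).
  by move=> z; apply: continuousB;
    [exact: cst_continuous | exact: coord_continuous].
by move=> j _ z; exact: continuousM (c j z) (c j z).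
Qed.

(** [A] may be infinite: this serves for polar bodies as well as for balls cut out by finitely many
    forms. *)
Lemma compact_polyhedron (A : set V) (B : R) :
  (forall z, (forall u, A u -> dot u z <= 1) -> forall j, `|z ord0 j| <= B) ->
  compact [set z | forall u, A u -> dot u z <= 1].
Proof.
move=> AB.
have clA : closed [set z : V | forall u, A u -> dot u z <= 1].
  have -> : [set z | forall u, A u -> dot u z <= 1] =
      \bigcap_(u in A) (dot u @^-1` [set r | r <= 1]) by [].
  apply: closed_bigI => u _; apply: preimage_closed; last exact: closed_le.
  by move=> z _; exact: continuous_dot.
have cB : compact [set z : V | forall j, `[- B, B]%classic (z ord0 j)].
  by apply: (@rV_compact _ _ (fun=> `[- B, B]%classic)) => _;
    exact: segment_compact.
apply: subclosed_compact clA cB _ => z /AB zB j /=.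
by rewrite in_itv/= -ler_norml.
Qed.

Lemma convexP K : convex_set K -> forall x y (t : R), 0 <= t <= 1 ->
  K x -> K y -> K (t *: x + (1 - t) *: y).
Proof.
move=> cK x y t /andP[t0 t1] Kx Ky.
have t01 : Itv.spec (@Itv.num_sem R) (Itv.Real `[0%Z, 1%Z]) t.
  by apply/and3P; split; rewrite ?num_real ?bnd_simp.
have := cK x y (Itv.mk t01); rewrite !inE; exact.
Qed.

(** The normal is [q - p], with [p] the point of [K] nearest to [q]: an obtuse angle at [p] fails
    only if moving from [p] towards [z] comes closer to [q]. *)
Lemma separation K q : compact K -> convex_set K -> K !=set0 -> ~ K q ->
  exists u, forall z, K z -> dot u z < dot u q.
Proof.
move=> cptK /convexP cK K0 Kq.
have [|p /set_mem Kp pmin] := compact_EVT_min K0 cptK (f := fun z => dot (q - z)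
  (q - z)).
  by apply: continuous_subspaceT; exact: continuous_sqdist.
exists (q - p) => z Kz.
have qp : 0 < dot (q - p) (q - p).
  by rewrite dot_gt0// subr_eq0; apply: contra_not_neq Kq => ->.
suff : dot (q - p) (z - p) <= 0 by move: qp; rewrite !dotBr; lra.
rewrite leNgt; apply/negP => zp0.
set D := dot (z - p) (z - p); have D0 : 0 <= D by exact: dot_ge0.
set s := dot (q - p) (z - p) in zp0.
(* This lies in (0, 1] and gives [t * D < s], so the squared distance changes by
   [t ^+ 2 * D - 2 * t * s < 0]. *)
pose t := s / (s + D).
have sD : 0 < s + D by rewrite ltr_wpDr.
have t0 : 0 < t by rewrite divr_gt0.
have t1 : t <= 1 by rewrite ler_pdivrMr// mul1r lerDl.
have /mem_set/pmin : K (t *: z + (1 - t) *: p) by apply: cK; rewrite ?(ltW t0).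
have -> : q - (t *: z + (1 - t) *: p) = (q - p) - t *: (z - p).
  by apply/rowP => j; rewrite !mxE; ring.
have -> a b : dot (a - t *: b) (a - t *: b) = dot a a - 2 * t * dot a b + t ^+ 2
  * dot b b.
  by rewrite dotBr !dotDl !dotNl dotZr !dotZl dotZr (dotC b a); ring.
rewrite -/s -/D => H.
have : t * (s + D) = s by rewrite divfK ?gt_eqF.
by nra.
Qed.

(** [z] is the midpoint of [p + 2 *: z] and [- p], which carries a ball about an interior point [p]
    to the origin. *)
Lemma body_nbhs0 K : o_symmetric_convex_body K ->
  exists2 r, 0 < r & forall z, (forall j, `|z ord0 j| <= r) -> K z.
Proof.
move=> [_ /convexP cK [p /nbhs_ballP[e /= e0 pe]] sK].
exists (e / 4); first by rewrite divr_gt0.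
move=> z zr; have -> : z = 2^-1 *: (p + 2 *: z) + (1 - 2^-1) *: (- p).
  by apply/rowP => j; rewrite !mxE; field.
have Kp : K p by apply: pe; exact: ballxx.
apply: cK; [lra | | exact: sK].
apply: pe; split=> // i j; rewrite ord1 /ball/= !mxE opprD addNKr normrN normrM.
by have := zr j; rewrite gtr0_norm//; lra.
Qed.

Lemma gauge_le K (l : R) z : 0 <= l -> K z -> gauge_norm K (l *: z) <= l.
Proof.
move=> l0 Kz; apply: ge_inf; first by exists 0 => ? [].
by split=> //; exists z.
Qed.

Lemma gauge_ge K u z : o_symmetric_convex_body K ->
  (forall q, K q -> dot u q <= 1) -> dot u z <= gauge_norm K z.
Proof.
move=> /body_nbhs0[r r0 Kr] uK.
apply: lb_le_inf => [|l [l0 [q Kq <-]]]; last first.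
  by rewrite dotZr -[leRHS]mulr1 ler_wpM2l// uK.
(* The infimum needs a nonempty set: dividing [z] by this [l] brings it into the cube inside [K]. *)
pose l := (\sum_j `|z ord0 j| + 1) / r.
have S0 : 0 <= \sum_j `|z ord0 j| by rewrite sumr_ge0.
have l0 : 0 < l by rewrite divr_gt0// ltr_pwDr.
exists l; split; first exact: ltW.
exists (l^-1 *: z); last by rewrite scalerA divff ?scale1r// gt_eqF.
apply: Kr => j; rewrite mxE normrM gtr0_norm ?invr_gt0//.
rewrite mulrC ler_pdivrMr// /l mulrCA divff ?gt_eqF// mulr1.
rewrite (bigD1 j)//= -addrA lerDl addr_ge0// sumr_ge0//.
Qed.

Lemma body_0 K : o_symmetric_convex_body K -> K 0.
Proof. by move=> /body_nbhs0[r r0]; apply => j; rewrite mxE normr0 ltW. Qed.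

(** Maximise [dot w] over the compact polar body. If the maximum were below the gauge, [w] scaled by
    a value [l] in between would be outside [K], and a separating form, normalised, would reach
    [l]. *)
Lemma polar_gauge K w : o_symmetric_convex_body K ->
  exists2 u, forall z, K z -> dot u z <= 1 & gauge_norm K w <= dot u w.
Proof.
move=> bK; have K0 := body_0 K bK; have [r r0 Kr] := body_nbhs0 K bK.
pose P := [set u | forall z, K z -> dot z u <= 1].
have cP : compact P.
  apply: (compact_polyhedron K r^-1) => u uP j.
  have Ke s : `|s| <= r -> K (s *: delta_mx ord0 j).
    move=> sr; apply: Kr => i; rewrite !mxE eqxx/= normrM.
    by case: (i == j); rewrite ?normr1 ?normr0 ?mulr1 ?mulr0// ltW.
  have := uP _ (Ke r _); have := uP _ (Ke (- r) _).
  rewrite normrN gtr0_norm// lexx !dotZl dot_delta => /(_ isT) H1 /(_ isT) H2.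
  by rewrite ler_norml -[r^-1]mul1r -mulNr ler_pdivlMr// ler_pdivrMr//; lra.
have [||u /set_mem uP umax] := compact_EVT_max _ cP (f := dot w).
- by exists 0 => z _; rewrite dot0r.
- by apply: continuous_subspaceT; exact: continuous_dot.
exists u => [z Kz|]; first by rewrite dotC uP.
rewrite leNgt; apply/negP; rewrite dotC => ltg.
have wu0 : 0 <= dot w u.
  by rewrite -(dot0r w) umax//; apply: mem_set => z _; rewrite dot0r.
pose l := (dot w u + gauge_norm K w) / 2.
have l0 : 0 < l by rewrite /l; lra.
have [v vK] : exists v, forall z, K z -> dot v z < dot v (l^-1 *: w).
  case: bK => cptK cK _ _; apply: separation => //; first by exists 0.
  move=> /(gauge_le K _ _ (ltW l0)); rewrite scalerA divff ?gt_eqF// scale1r.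
  by rewrite /l; lra.
have t0 : 0 < dot v (l^-1 *: w) by rewrite -(dot0r v) vK.
set t := dot v _ in vK t0.
have : dot w (t^-1 *: v) <= dot w u.
  apply/umax/mem_set => z Kz; rewrite dotZr dotC mulrC.
  by rewrite ler_pdivrMr// mul1r ltW// vK.
have -> : dot w (t^-1 *: v) = l.
  rewrite dotZr; have := erefl t; rewrite {2}/t dotZr dotC => tE.
  have {tE} -> : dot w v = l * t by rewrite tE mulrA divff ?mul1r// gt_eqF.
  by rewrite mulrCA mulVf ?mulr1// gt_eqF.
by rewrite /l; lra.
Qed.

(** The form [dot z] divided by its maximum over [K] lies in the polar body and is positive at
    [z]. *)
Lemma gauge_gt0 K z : o_symmetric_convex_body K -> z != 0 -> 0 < gauge_norm K z.
Proof.
move=> bK z0; have [r r0 Kr] := body_nbhs0 K bK.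
have [||v /set_mem vK vmax] := compact_EVT_max _ (let: And4 c _ _ _ := bK in c)
  (f := dot z).
- by exists 0; exact: body_0.
- by apply: continuous_subspaceT; exact: continuous_dot.
have M0 : 0 < dot z v.
  pose S := \sum_j `|z ord0 j| + 1.
  have S0 : 0 < S by rewrite ltr_pwDr// sumr_ge0.
  apply: (@lt_le_trans _ _ (dot z ((r / S) *: z))).
    by rewrite dotZr mulr_gt0 ?dot_gt0 ?divr_gt0.
  apply/vmax/mem_set/Kr => j; rewrite mxE normrM gtr0_norm ?divr_gt0//.
  rewrite mulrAC ler_pdivrMr// ler_pM2l// /S (bigD1 j)//= -addrA lerDl.
  by rewrite addr_ge0// sumr_ge0.
apply: lt_le_trans (gauge_ge K ((dot z v)^-1 *: z) z bK _) => [|q Kq].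
  by rewrite dotZl mulr_gt0 ?invr_gt0 ?dot_gt0.
by rewrite dotZl mulrC ler_pdivrMr// mul1r vmax// mem_set.
Qed.

Lemma gauge_diameter K X x y : x \in X -> y \in X ->
  gauge_norm K (x - y) <= diameter K X.
Proof.
move=> xX yX; apply: ub_le_sup; last by exists (x, y).
exists (\sum_(p <- X) \sum_(q <- X) `|gauge_norm K (p - q)|).
move=> _ [[p q] [/= pX qX] <-]; apply: le_trans (ler_norm _) _.
rewrite (bigD1_seq p) ?fset_uniq//= (bigD1_seq q) ?fset_uniq//= -addrA lerDl.
by rewrite addr_ge0 ?sumr_ge0// => *; rewrite sumr_ge0.
Qed.

Lemma diametral_antipodal K k X : o_symmetric_convex_body K ->
  k_diametral K k X -> k_antipodal k X.
Proof.
move=> bK [D0 kX]; apply/k_antipodalP => Y YX Yk.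
have [x [y [xY yY _ xyD]]] := kX Y YX Yk; exists x, y; split=> //.
have [xX yX] := (fsubsetP YX _ xY, fsubsetP YX _ yY).
have [u uK] := polar_gauge K (x - y) bK; rewrite xyD => uxy.
(* Applied to [p - y] and [x - p], this places [dot u p] between [dot u y] and [dot u x]. *)
have uX p q : p \in X -> q \in X -> dot u (p - q) <= dot u (x - y).
  move=> pX qX; apply: le_trans uxy;
    apply: le_trans (gauge_diameter K X p q pX qX).
  exact: gauge_ge.
exists u; split=> [|p pX]; first by rewrite -subr_gt0 -dotBr (lt_le_trans D0).
have := uX p y pX yX; have := uX x p xX pX; rewrite !dotBr; lra.
Qed.

Lemma fset_two_points X : (2 <= #|` X|)%N ->
  exists x y, [/\ x \in X, y \in X & x != y].
Proof.
move=> X2; have /fset0Pn[x xX] : X != fset0 by rewrite -cardfs_gt0 ltnW.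
have /fset0Pn[y] : (X `\ x)%fset != fset0.
  by move: X2; rewrite -cardfs_gt0 (cardfsD1 x) xX.
by rewrite !inE => /andP[yx yX]; exists y, x.
Qed.

Lemma polyhedral_body (S : seq V) (B : R) : 0 < B ->
  (forall u, u \in S -> - u \in S) -> (forall j, B^-1 *: delta_mx ord0 j \in S)
    ->
  o_symmetric_convex_body [set z | forall u, u \in S -> dot u z <= 1].
Proof.
move=> B0 SN SB; split.
- apply: (compact_polyhedron [set` S] B) => z zS j.
  have := zS _ (SB j); have := zS _ (SN _ (SB j)).
  rewrite dotNl dotZl dot_delta -mulrN -normrN ![B^-1 * _]mulrC !ler_pdivrMr//.
  by rewrite !mul1r ler_norml; lra.
- move=> x y l; rewrite !inE => xS yS u uS.
  have := convex_halfspace u 1 x y l; rewrite !inE; apply; first exact: xS.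
  exact: yS.
- have [|r r0 rS] := polytope_nbhs [seq (u, 1 : R) | u <- S] 0.
    by move=> _ /mapP[u _ ->]; rewrite dot0r.
  exists 0; apply/nbhs_ballP; exists r => // z [_ zr] u uS.
  apply/ltW/(rS z _ (u, 1)); last exact: map_f.
  by move=> j; have := zr ord0 j; rewrite /ball/= distrC => /ltW.
- by move=> z zS u /SN/zS; rewrite dotNl dotNr.
Qed.

Lemma antipodal_diametral k X : (2 <= #|` X|)%N -> k_antipodal k X ->
  exists K, o_symmetric_convex_body K /\ k_diametral K k X.
Proof.
move=> X2 /k_antipodalP kX.
pose w s := xget 0 [set u | separates_as u X s.1 s.2].
have wP s : antipodal X s.1 s.2 -> separates_as (w s) X s.1 s.2.
  exact: xgetPex.
pose n s := (dot (w s) (s.1 - s.2))^-1 *: w s.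
pose pairs := [seq s <- [seq (x, y) | x <- X, y <- X] | `[< antipodal X s.1 s.2
  >]].
(* Bounds every coordinate of every difference, so the box contains [X - X]. *)
pose B := 1 + \sum_(x <- X) \sum_(y <- X) \sum_j `|(x - y) ord0 j|.
pose e j : V := B^-1 *: delta_mx ord0 j.
have B0 : 0 < B.
  by rewrite ltr_pwDl// sumr_ge0// => x _; rewrite sumr_ge0// => y _;
    rewrite sumr_ge0.
pose S0 := [seq n s | s <- pairs] ++ [seq e j | j <- enum 'I_d].
pose S := S0 ++ [seq - u | u <- S0].
have SN u : u \in S -> - u \in S.
  rewrite !(mem_cat _ S0) => /orP[uS|/mapP[v vS ->]];
    first by rewrite map_f ?orbT.
  by rewrite opprK vS.
have eS j : e j \in S.
  by rewrite !mem_cat (map_f e (mem_enum _ j)) orbT.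
have bK := polyhedral_body S B B0 SN eS; set K := [set z | _] in bK.
have XS0 u p q : u \in S0 -> p \in X -> q \in X -> dot u (p - q) <= 1.
  rewrite mem_cat => /orP[/mapP[z]|/mapP[j _ ->]] => [|pX qX].
    rewrite mem_filter => /andP[/asboolP/wP[zlt zX] _] -> /zX/andP[_ pz]
      /zX/andP[qz _].
    have z0 : 0 < dot (w z) (z.1 - z.2) by rewrite dotBr subr_gt0.
    by rewrite dotZl mulrC ler_pdivrMr// mul1r !dotBr; lra.
  rewrite dotZl dot_delta mulrC ler_pdivrMr// mul1r /B.
  rewrite (bigD1_seq p) ?fset_uniq//= (bigD1_seq q) ?fset_uniq//= (bigD1 j)//=.
  have := ler_norm ((p - q) ord0 j).
  have : 0 <= \sum_(i < d | i != j) `|(p - q) ord0 i| by rewrite sumr_ge0.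
  have : 0 <= \sum_(y <- X | y != q) \sum_j `|(p - y) ord0 j|.
    by rewrite sumr_ge0// => y _; rewrite sumr_ge0.
  have : 0 <= \sum_(x <- X | x != p) \sum_(y <- X) \sum_j `|(x - y) ord0 j|.
    by rewrite sumr_ge0// => x _; rewrite sumr_ge0// => y _; rewrite sumr_ge0.
  by lra.
have XK p q : p \in X -> q \in X -> K (p - q).
  move=> pX qX u; rewrite mem_cat => /orP[uS|/mapP[v vS ->]]; first exact: XS0.
  by rewrite dotNl -dotNr opprB XS0.
have X1 p q : p \in X -> q \in X -> gauge_norm K (p - q) <= 1.
  by move=> pX qX; rewrite -[p - q]scale1r gauge_le//; exact: XK.
have [a [b [aX bX ab]]] := fset_two_points X X2.
exists K; split=> //; split.
  apply: lt_le_trans (gauge_diameter K X a b aX bX).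
  by apply: gauge_gt0; rewrite ?subr_eq0.
move=> Y YX Yk; have [x [y [xY yY xy]]] := kX Y YX Yk; exists x, y.
have [xX yX] := (fsubsetP YX _ xY, fsubsetP YX _ yY).
have [wyx _] := wP (x, y) xy.
split=> //; first by apply: contraTneq wyx => /= ->; rewrite ltxx.
apply/eqP; rewrite eq_le gauge_diameter//=.
(* All differences have norm at most 1, while the normalised form of the pair takes the value 1 at
   [x - y]. *)
apply: (@le_trans _ _ 1).
  by apply: ge_sup => [|_ [[p q] [pX qX] <-]];
    [exists (gauge_norm K (a - b)), (a, b) | exact: X1].
have -> : 1 = dot (n (x, y)) (x - y).
  by rewrite dotZl mulVf// dotBr subr_eq0 gt_eqF.
apply: gauge_ge => // q; apply; rewrite !mem_cat map_f// mem_filter.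
by apply/andP; split; [exact/asboolP | apply/allpairsP; exists (x, y)].
Qed.

End ConvexBody.

(** * Attained maxima and explicit point sets *)

Lemma exists_maximum (A : set nat) (N : nat) :
  A !=set0 -> ubound A N -> is_maximum A (maximum A).
Proof.
move=> [n0 An0] AN; apply: xgetPex.
have ex : exists n, `[< A n >] by exists n0; apply/asboolP.
have le n : `[< A n >] -> (n <= N)%N by move=> /asboolP /AN.
by have [m /asboolP Am mmax] := ex_maxnP ex le; exists m;
  split=> // n /asboolP/mmax.
Qed.

Section LowerBound.
Context {R : realType} {d : nat}.
Local Notation V := 'rV[R]_d.+1.

(** Coordinate 0 is the position on the line; the other [d] coordinates give a cube vertex, so the
    ambient dimension is [d.+1]. *)
Definition prism_point k (z : 'I_k * {ffun 'I_d -> bool}) : V :=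
  \row_j (if unlift ord0 j is Some i then (z.2 i)%:R else (z.1 : nat)%:R).

Lemma prism_point0 k z : prism_point k z ord0 ord0 = (z.1 : nat)%:R.
Proof. by rewrite mxE unlift_none. Qed.

Lemma prism_pointS k z i : prism_point k z ord0 (lift ord0 i) = (z.2 i)%:R.
Proof. by rewrite mxE liftK. Qed.

Lemma prism_point_inj k : injective (prism_point k).
Proof.
move=> [a b] [a' b'] ab; congr pair.
  apply/val_inj/eqP; rewrite -(eqr_nat R).
  by rewrite -(prism_point0 k (a, b)) ab prism_point0.
apply/ffunP => i; apply/eqP; have := prism_pointS k (a, b) i.
rewrite ab prism_pointS /= => /eqP; rewrite eqr_nat.
by case: (b i) (b' i) => -[].
Qed.

(* Two points with different [{0,1}]-coordinates are antipodal; [k] points that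
   agree there form a whole segment fibre, whose end points are antipodal. *)
Lemma k_antipodal_prism k : (2 <= k)%N ->
  exists X : {fset V}, k_antipodal k X /\ #|` X| = (k * 2 ^ d)%N.
Proof.
case: k => // k k2; pose f := prism_point k.+1;
  have f_inj := prism_point_inj k.+1.
exists [fset x in map f (enum predT)]%fset; set X := [fset x in _]%fset.
have XE x : x \in X -> exists z, x = f z by rewrite inE => /mapP[z _ ->];
  exists z.
have fX z : f z \in X by rewrite inE map_f// mem_enum.
split; last first.
  rewrite card_fseq undup_id ?(map_inj_uniq f_inj) ?enum_uniq// size_map -cardE.
  by rewrite card_prod card_ord card_ffun card_bool card_ord.
have sep j z z' : (forall t, f z' ord0 j <= f t ord0 j <= f z ord0 j) ->
    f z' ord0 j < f z ord0 j -> antipodal X (f z) (f z').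
  move=> H1 H2; exists (delta_mx ord0 j); split; first by rewrite !dot_delta.
  by move=> _ /XE[t ->]; rewrite !dot_delta.
have sepS i (z z' : 'I_k.+1 * {ffun 'I_d -> bool}) : z.2 i -> ~~ z'.2 i ->
  antipodal X (f z) (f z').
  move=> zi z'i; apply: (sep (lift ord0 i)) => [t|];
    rewrite !prism_pointS zi (negbTE z'i) ?ler_nat ?ltr_nat//.
  by case: (t.2 i).
apply/k_antipodalP => Y YX Yk.
have /fset0Pn[y0 y0Y] : Y != fset0 by rewrite -cardfs_gt0 Yk.
have [[a0 b0] y0E] := XE _ (fsubsetP YX _ y0Y).
have [[[a b] [abY /eqP bb0]]|Yb] := pselect (exists z, f z \in Y /\ z.2 <> b0).
  have /existsP[i bi] : [exists i, b i != b0 i].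
    apply: contraNT bb0; rewrite negb_exists => /forallP H;
      apply/eqP/ffunP => i.
    by have := H i; rewrite negbK => /eqP.
  have [b0i|b0i] := boolP (b0 i).
    exists y0, (f (a, b)); split=> //; rewrite y0E; apply: (sepS i) => //=.
    by move: bi; rewrite b0i; case: (b i).
  exists (f (a, b)), y0; split=> //; rewrite y0E; apply: (sepS i) => //=.
  by move: bi; rewrite (negbTE b0i); case: (b i).
pose F := [fset x in map (fun a => f (a, b0)) (enum 'I_k.+1)]%fset.
have YF : Y = F.
  apply/eqP; rewrite eqEfcard; apply/andP; split.
    apply/fsubsetP => y yY; have [[a b] yE] := XE _ (fsubsetP YX _ yY).
    have -> : y = f (a, b0).
      rewrite yE; congr (f (a, _)); apply: contrapT => bb0.
      by apply: Yb; exists (a, b); rewrite -yE.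
    by rewrite inE; apply/mapP; exists a; rewrite ?mem_enum.
  rewrite Yk card_fseq (leq_trans (size_undup _))// size_map -cardE card_ord.
  exact: leqnn.
have FY a : f (a, b0) \in Y by rewrite YF inE; apply/mapP; exists a;
  rewrite ?mem_enum.
exists (f (ord_max, b0)), (f (ord0, b0)); split=> //.
apply: (sep ord0) => [t|]; rewrite !prism_point0 /= ?ler_nat ?ltr_nat//.
by rewrite leq0n -ltnS ltn_ord.
Qed.

(** Provides a member of the set of cardinalities defining [g_], so that its maximum is attained. *)
Lemma two_point_diametral k (K : set V) : (2 <= k)%N -> o_symmetric_convex_body
  K ->
  exists X, k_diametral K k X /\ #|` X| = 2%N.
Proof.
move=> k2 bK; pose e : V := const_mx 1; pose X := [fset e; 0]%fset.
have e0 : e != 0 by apply/eqP => /rowP /(_ ord0); rewrite !mxE;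
  apply/eqP/oner_neq0.
have X2 : #|` X| = 2%N by rewrite cardfs2 e0.
have [eX zX] : e \in X /\ 0 \in X by rewrite !inE !eqxx orbT.
exists X; split=> //; split.
  apply: lt_le_trans (gauge_diameter K X e 0 eX zX).
  by apply: gauge_gt0; rewrite ?subr0.
(* Since [k >= 2], a [k]-subset of a two-point set is the whole set. *)
move=> Y YX Yk; have YE : Y = X.
  by apply/eqP; rewrite eqEfcard YX X2 Yk.
rewrite YE.
have D : diameter K X <= Num.max (gauge_norm K (e - 0)) (gauge_norm K (0 - e)).
  apply: ge_sup; first by exists (gauge_norm K (e - 0)), (e, 0).
  have g0 : gauge_norm K 0 <= gauge_norm K (e - 0).
    apply: (@le_trans _ _ 0); last by apply/ltW/gauge_gt0; rewrite ?subr0.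
    by rewrite -[X in gauge_norm K X](scale0r 0) gauge_le//; exact: body_0.
  move=> _ [[p q] [/= pX qX] <-]; move: pX qX; rewrite /= !inE.
  by move=> /orP[]/eqP-> /orP[]/eqP->; rewrite le_max ?subrr ?g0 ?lexx ?orbT.
move: D; rewrite le_max => /orP[D|D].
  by exists e, 0; split=> //; apply/eqP; rewrite eq_le D gauge_diameter.
by exists 0, e; split; rewrite // 1?eq_sym//; apply/eqP;
  rewrite eq_le D gauge_diameter.
Qed.

End LowerBound.

(** * The equivalence, the maxima and the two bounds *)

Theorem theorem9 (R : realType) (d k : nat) (hd : (2 <= d)%N) (hk : (2 <= k)%N) :
  (forall X : {fset 'rV[R]_d}, (2 <= #|` X|)%N ->
     (k_antipodal k X <->
      exists K : set 'rV[R]_d, o_symmetric_convex_body K /\ k_diametral K k X))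
  /\
  [/\ is_maximum [set #|` X| | X in [set X : {fset 'rV[R]_d} | k_antipodal k X]]
        (G_ R d k),
      (forall K : set 'rV[R]_d, o_symmetric_convex_body K ->
         is_maximum [set #|` X| | X in [set X | k_diametral K k X]] (g_ k K)) &
      is_maximum
        [set g_ k K | K in [set K : set 'rV[R]_d | o_symmetric_convex_body K]]
        (G_ R d k)]
  /\
  ((3 <= d)%N -> (3 <= k)%N ->
     (k * 2 ^ (d - 1) <= G_ R d k)%N /\
     (G_ R d k <= (k - 1) * 2 ^ d - 1)%N).
Proof.
have k0 : (0 < k)%N := ltnW hk.
case: d hd => // d hd.
have equiv (X : {fset 'rV[R]_d.+1}) : (2 <= #|` X|)%N ->
    (k_antipodal k X <->
     exists K : set 'rV[R]_d.+1, o_symmetric_convex_body K /\ k_diametral K k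
       X).
  move=> X2; split; first exact: antipodal_diametral.
  by move=> [K [bK]]; exact: diametral_antipodal.
have [X0 [kX0 X0E]] := @k_antipodal_prism R d k hk.
have maxG : is_maximum
    [set #|` X| | X in [set X : {fset 'rV[R]_d.+1} | k_antipodal k X]] (G_ R
      d.+1 k).
  apply: (@exists_maximum _ ((k - 1) * 2 ^ d.+1)); first by exists #|` X0|, X0.
  by move=> _ [X kX <-]; exact: card_k_antipodal.
have maxg (K : set 'rV[R]_d.+1) : o_symmetric_convex_body K ->
    is_maximum [set #|` X| | X in [set X | k_diametral K k X]] (g_ k K).
  move=> bK; apply: (@exists_maximum _ ((k - 1) * 2 ^ d.+1)).
    by have [X [kX _]] := two_point_diametral k K hk bK; exists #|` X|, X.
  by move=> _ [X kX <-]; apply: card_k_antipodal => //;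
    exact: diametral_antipodal kX.
have [[X kX XE] Gub] := maxG.
have X0G : (k * 2 ^ d <= G_ R d.+1 k)%N by rewrite -X0E; apply: Gub; exists X0.
have gG (K : set 'rV[R]_d.+1) : o_symmetric_convex_body K -> (g_ k K <= G_ R
  d.+1 k)%N.
  move=> bK; have [[Y kY <-] _] := maxg K bK; apply: Gub; exists Y => //.
  exact: diametral_antipodal kY.
split=> //; split.
  split=> //; split=> [|_ [K bK <-]]; last exact: gG.
  (* The prism makes an extremal [X] large enough for the equivalence; the body it yields attains
     [G_]. *)
  have X2 : (2 <= #|` X|)%N.
    by rewrite XE (leq_trans _ X0G)// (leq_trans hk)// leq_pmulr// expn_gt0.
  have [K [bK kKX]] := antipodal_diametral k X X2 kX; exists K => //.
  apply/eqP; rewrite eqn_leq gG//=; have [_ gub] := maxg K bK.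
  by rewrite -XE; apply: gub; exists X.
move=> _ k3; split; first by rewrite subn1.
(* The strict bound gives the final [- 1]; it also makes the product positive, so the truncated
   subtraction is exact. *)
have := card_k_antipodal_lt k X k3 kX; rewrite XE => Glt.
by rewrite subn1 -ltnS prednK// (leq_ltn_trans _ Glt).
Qed.
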